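(* Suppose that $-1\le\beta<\alpha<1$ and $\alpha>0$, and let $\lambda=\frac{1-\alpha}{\alpha-\beta}$. If $S$ is a spherical $\{\alpha,\beta\}$-code of size $n$ and rank $r$, and $A$ denotes the adjacency matrix of $G=\Gamma_\beta(S)$, then one of the following holds: (1) $\lambda_1(G)<\lambda$ and $n=r$. (2) $\lambda_1(G)=\lambda$, and this eigenvalue of $G$ has codimension $r-1$. (3) ${\rm in}_-(\lambda I-A)=1$, ${\rm j}\in R(\lambda I-A)$, ${\rm j}^\top(\lambda I-A)^\#{\rm j}\le\frac{\alpha-\beta}{-\alpha}$, and $$\mathrm{rank}(\lambda I-A)=\begin{cases} r+1 & \text{if } {\rm j}^\top(\lambda I-A)^\#{\rm j}=\frac{\alpha-\beta}{-\alpha},\\ r & \text{otherwise.}\end{cases}$$ Conversely, if an $n$-vertex graph $G$ with adjacency matrix $A$ satisfies one of (1), (2), (3) (for an integer $r$), then there exists a spherical $\{\alpha,\beta\}$-code $S$ of rank $r$ such that $\Gamma_\beta(S)=G$.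
   Context: For $\beta<\alpha<1$, a spherical $\{\alpha,\beta\}$-code is a finite nonempty set $S$ of unit vectors in some $\mathbb{R}^m$ such that $x^\top y\in\{\alpha,\beta\}$ for any two distinct $x,y\in S$ (it is allowed that only one of the values occurs). The rank of $S$ is the dimension of the linear span of $S$. For $S=\{u_1,\dots,u_n\}$, the associated $\beta$-graph $\Gamma_\beta(S)$ is the simple graph with vertex set $S$ in which $u_i,u_j$ ($i\neq j$) are adjacent iff $u_i^\top u_j=\beta$. Equality $\Gamma_\beta(S)=G$ is understood up to graph isomorphism. Graphs are finite and simple; $\lambda_1(G)$ is the largest eigenvalue of the adjacency matrix $A_G$ of $G$. For an eigenvalue $\lambda$ of an $n$-vertex graph $G$ with multiplicity $m$, its codimension in $G$ is $n-m=\mathrm{rank}(\lambda I-A_G)$. For a real symmetric matrix $M$, ${\rm in}_-(M)$ is the number of negative eigenvalues of $M$ (with multiplicity). ${\rm j}$ is the all-ones column vector, and $R(M)$ is the column space of $M$. The group inverse $M^\#$ of a square matrix $M$ is the (unique, if it exists) matrix $X$ with $MXM=M$, $XMX=X$, $MX=XM$; it exists for every real symmetric matrix. *)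

(* Defs.v *)
From HB Require Import structures.
From mathcomp Require Import all_boot all_order all_algebra.
From mathcomp Require Import finmap.
From mathcomp Require Import boolp classical_sets reals.
From mathcomp Require Import polyrcf.
Set Implicit Arguments.
Unset Strict Implicit.
Unset Printing Implicit Defensive.
Import Order.TTheory GRing.Theory Num.Theory.
Local Open Scope ring_scope.

Record sgraph := SGraph {
  vertex :> finType;
  edge : rel vertex;
  edge_sym : symmetric edge;
  edge_irrefl : irreflexive edge }.

Definition isomorphic (G H : sgraph) : Prop :=
  exists f : G -> H,
    bijective f /\ forall x y : G, edge (f x) (f y) = edge x y.

Definition adjacency (R : realType) (G : sgraph) : 'M[R]_#|G| :=
  \matrix_(i, j) (edge (enum_val i) (enum_val j))%:R.

(* [rootsR p] lists the distinct real roots of [p] (for [p != 0]), and the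
   roots of [char_poly M] are the eigenvalues of [M]. *)
Definition eigenvalues (R : realType) n (M : 'M[R]_n) : seq R :=
  rootsR (char_poly M).

(* The starting value of the maximum is itself an eigenvalue as soon as there
   is one, which is the case for symmetric [M] of size [n > 0]. *)
Definition lambda1 (R : realType) n (M : 'M[R]_n) : R :=
  \big[Num.max/head 0 (eigenvalues M)]_(x <- eigenvalues M) x.

(* Geometric multiplicity, the same as the algebraic one for symmetric [M];
   [eigenspace] consists of left eigenvectors, which does not affect its
   dimension. *)
Definition multiplicity (R : realType) n (M : 'M[R]_n) (x : R) : nat :=
  \rank (eigenspace M x).

Definition codimension (R : realType) n (M : 'M[R]_n) (x : R) : nat :=
  (n - multiplicity M x)%N.

Definition neg_inertia (R : realType) n (M : 'M[R]_n) : nat :=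
  (\sum_(x <- eigenvalues M | (x < 0)%R) multiplicity M x)%N.

Definition allones (R : realType) n : 'cV[R]_n := const_mx 1.

(* The library works with row spaces, hence the transpositions. *)
Definition in_colspace (R : realType) n (v : 'cV[R]_n) (M : 'M[R]_n) : bool :=
  (v^T <= M^T)%MS.

Definition is_group_inverse (R : realType) n (M X : 'M[R]_n) : Prop :=
  [/\ M *m X *m M = M, X *m M *m X = X & M *m X = X *m M].

(* The group inverse is unique when it exists; the default value 0 is only
   used when it does not, which never happens for symmetric [M]. *)
Definition group_inverse (R : realType) n (M : 'M[R]_n) : 'M[R]_n :=
  xget 0 [set X | is_group_inverse M X]%classic.

Definition dot (R : realType) m (x y : 'cV[R]_m) : R := (x^T *m y) 0 0.

Lemma dotC (R : realType) m (x y : 'cV[R]_m) : dot x y = dot y x.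
Proof. by rewrite /dot -[x in RHS]trmxK -trmx_mul [RHS]mxE. Qed.

Definition spherical_code (R : realType) (alpha beta : R) m
    (S : {fset 'cV[R]_m}) : Prop :=
  [/\ S != fset0,
      forall x, x \in S -> dot x x = 1
    & forall x y, x \in S -> y \in S -> x != y ->
        dot x y = alpha \/ dot x y = beta].

Definition code_rank (R : realType) m (S : {fset 'cV[R]_m}) : nat :=
  \dim <<enum_fset S>>%VS.

Definition beta_edge (R : realType) (beta : R) m (S : {fset 'cV[R]_m}) :
    rel S :=
  fun x y => (x != y) && (dot (val x) (val y) == beta).

Lemma beta_edge_sym (R : realType) (beta : R) m (S : {fset 'cV[R]_m}) :
  symmetric (@beta_edge R beta m S).
Proof. by move=> x y; rewrite /beta_edge eq_sym dotC. Qed.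

Lemma beta_edge_irrefl (R : realType) (beta : R) m (S : {fset 'cV[R]_m}) :
  irreflexive (@beta_edge R beta m S).
Proof. by move=> x; rewrite /beta_edge eqxx. Qed.

Definition beta_graph (R : realType) (beta : R) m (S : {fset 'cV[R]_m}) :
    sgraph :=
  SGraph (@beta_edge_sym R beta m S) (@beta_edge_irrefl R beta m S).

(* [r] ranges over the integers, so that [r - 1] is the genuine difference. *)
Definition code_alternative (R : realType) (alpha beta : R) (G : sgraph)
    (n : nat) (r : int) : Prop :=
  let lambda := (1 - alpha) / (alpha - beta) in
  let A := adjacency R G in
  let M := lambda%:M - A in
  let j := allones R #|G| in
  let q := (j^T *m group_inverse M *m j) 0 0 in
  let bound := (alpha - beta) / (- alpha) in
  [\/ lambda1 A < lambda /\ n%:Z = r,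
      lambda1 A = lambda /\ (codimension A lambda)%:Z = r - 1
    | [/\ neg_inertia M = 1%N,
          in_colspace j M,
          q <= bound
        & (\rank M)%:Z = if q == bound then r + 1 else r]].

(* Main.v *)
(** Up to the factor [alpha - beta], the Gram matrix of a code with beta-graph
    [G] is [N = M + c *: (j *m j^T)], where [M = lambda%:M - A] and
    [c = alpha / (alpha - beta) > 0]; conversely a positive semidefinite [N]
    factors as a Gram matrix.  So each direction amounts to the equivalence of
    the three alternatives with "[N] is positive semidefinite of rank [r]".
    If [M] is positive definite, so is [N].  If [M] is positive semidefinite and
    singular, its kernel contains a nonzero entrywise nonnegative vector
    (Perron-Frobenius), hence [j] is not in the range of [M] and the rank grows
    by one.  Otherwise [N >= 0] forces [M] to have a single negative eigenvalue
    and [j = M w]; then [N >= 0] iff [1 + c (j^T w) <= 0], and equality decides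
    whether the rank drops by one. *)
Require Import Defs.
From mathcomp Require Import all_boot all_order all_algebra.
From mathcomp Require Import finmap.
From mathcomp Require Import boolp reals polyrcf complex.
From mathcomp Require Import ring lra.
Set Implicit Arguments.
Unset Strict Implicit.
Unset Printing Implicit Defensive.
Import Order.TTheory GRing.Theory Num.Theory.
Local Open Scope ring_scope.

(** * Bilinearity and positivity of the dot product *)

Section Dot.
Variable R : realType.

Lemma dotE m (x y : 'cV[R]_m) : dot x y = \sum_i x i 0 * y i 0.
Proof. by rewrite /dot mxE; apply: eq_bigr => i _; rewrite mxE. Qed.

Lemma dotDr m (x y z : 'cV[R]_m) : dot x (y + z) = dot x y + dot x z.
Proof. by rewrite /dot mulmxDr mxE. Qed.

Lemma dotDl m (x y z : 'cV[R]_m) : dot (x + y) z = dot x z + dot y z.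
Proof. by rewrite dotC dotDr !(dotC z). Qed.

Lemma dotZr m a (x y : 'cV[R]_m) : dot x (a *: y) = a * dot x y.
Proof. by rewrite /dot -scalemxAr mxE. Qed.

Lemma dotZl m a (x y : 'cV[R]_m) : dot (a *: x) y = a * dot x y.
Proof. by rewrite dotC dotZr dotC. Qed.

Lemma dot0r m (x : 'cV[R]_m) : dot x 0 = 0.
Proof. by rewrite /dot mulmx0 mxE. Qed.

Lemma dotNr m (x y : 'cV[R]_m) : dot x (- y) = - dot x y.
Proof. by rewrite /dot mulmxN mxE. Qed.

Lemma dot_mull m p (M : 'M[R]_(p, m)) (x : 'cV[R]_m) (y : 'cV[R]_p) :
  dot (M *m x) y = dot x (M^T *m y).
Proof. by rewrite /dot trmx_mul mulmxA. Qed.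

Lemma dot_ge0 m (x : 'cV[R]_m) : 0 <= dot x x.
Proof. by rewrite dotE sumr_ge0 // => i _; rewrite -expr2 sqr_ge0. Qed.

Lemma dot_eq0 m (x : 'cV[R]_m) : (dot x x == 0) = (x == 0).
Proof.
apply/idP/idP => [|/eqP ->]; last by rewrite dot0r.
rewrite dotE psumr_eq0 => [/allP x0|i _]; last by rewrite -expr2 sqr_ge0.
apply/eqP/colP => i; rewrite mxE.
by have := x0 i (mem_index_enum _); rewrite /= mulf_eq0 orbb => /eqP.
Qed.

Lemma dot_gt0 m (x : 'cV[R]_m) : x != 0 -> 0 < dot x x.
Proof. by move=> x0; rewrite lt0r dot_eq0 x0 dot_ge0. Qed.

Lemma mul_outer m (x y z : 'cV[R]_m) : x *m y^T *m z = dot y z *: x.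
Proof.
by apply/colP => i; rewrite -mulmxA !mxE big_ord1 mulrC.
Qed.

End Dot.

(** * Spectral theorem for real symmetric matrices, Gram factorization, and counting of
    eigenvalues *)

Section Spectral.
Variable R : realType.

(** An eigenvalue exists over the complex numbers. Hermitian symmetry makes it real, so it is
    already an eigenvalue over [R]; a left eigenvector there transposes to a right one. *)
Lemma sym_eigenvector n (M : 'M[R]_n.+1) : M^T = M ->
  exists a, exists2 v : 'cV[R]_n.+1, v != 0 & M *m v = a *: v.
Proof.
move=> symM; pose f := real_complex R; pose C := map_mx f M.
have [z ez] := eigenvalue_closed C (ltn0Sn n).
have [v vC v_neq0] := eigenvalueP ez.
pose vb := (map_mx Num.conj v)^T.
have symC : C^T = C by rewrite map_trmx symM.
have conjCE : map_mx Num.conj C = C.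
  by apply/matrixP => i j; rewrite !mxE; apply: conjc_real.
have form_conj D : D^T = D -> map_mx Num.conj D = D ->
    Num.conj ((v *m D *m vb) 0 0) = (v *m D *m vb) 0 0.
  move=> symD conjD; transitivity ((map_mx Num.conj (v *m D *m vb))^T 0 0).
    by rewrite !mxE.
  have vK : map_mx Num.conj (map_mx Num.conj v) = v.
    by apply/matrixP => i j; rewrite !mxE; apply: conjcK.
  rewrite !map_mxM /= conjD /vb -map_trmx vK.
  by rewrite trmx_mul trmxK trmx_mul symD mulmxA.
have vv_neq0 : (v *m vb) 0 0 != 0.
  apply: contra v_neq0; rewrite mxE psumr_eq0 => [/allP v0|i _].
    apply/eqP/rowP => i; rewrite mxE; apply/eqP.
    by have := v0 i (mem_index_enum _); rewrite /= !mxE mul_conjC_eq0.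
  by rewrite !mxE mul_conjC_ge0.
(* The eigenvalue is a quotient of two hermitian forms, hence real. *)
have zconj : Num.conj z = z.
  have := form_conj C symC conjCE; rewrite vC -scalemxAl mxE rmorphM /=.
  rewrite -[v in v *m vb]mulmx1 form_conj ?trmx1 ?map_mx1 // mulmx1.
  by move/(mulIf vv_neq0).
have zE : z = f (complex.Re z).
  by case: (z) zconj => a b [/eqP]; rewrite eqNr => /eqP ->.
move: ez; rewrite zE eigenvalue_map => /eigenvalueP[x xM x_neq0].
exists (complex.Re z), x^T; first by rewrite trmx_eq0.
by rewrite -[M]symM -trmx_mul xM linearZ.
Qed.

(* [H] is the reflection exchanging [v] with a multiple of the first basis
   vector; conjugating a symmetric matrix by it splits off the eigenvector
   [v]. *)
Lemma householder n (v : 'cV[R]_n.+1) : v != 0 ->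
  exists2 H : 'M[R]_n.+1, H^T = H /\ H *m H = 1%:M
    & exists k, H *m v = k *: delta_mx 0 0.
Proof.
move=> v_neq0; set e : 'cV[R]_n.+1 := delta_mx 0 0.
have ee : dot e e = 1.
  by rewrite dotE (bigD1 0) //= big1 ?mxE ?mulr1 ?addr0 // => i /negbTE i0;
     rewrite !mxE i0 mul0r.
(* Since [v] and [k *: e] have the same length, the reflection along their difference [w] exchanges
   them. If [w = 0] they coincide and the identity does. *)
pose k := Num.sqrt (dot v v).
have kk : k * k = dot v v by rewrite -expr2 sqr_sqrtr // dot_ge0.
pose w := v - k *: e.
have [w0|w_neq0] := eqVneq w 0.
  exists 1%:M; first by rewrite trmx1 mul1mx.
  by exists k; rewrite mul1mx; apply/eqP; rewrite -subr_eq0 -/w w0.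
have ww_neq0 : dot w w != 0 by rewrite dot_eq0.
pose H : 'M[R]_n.+1 := 1%:M - (2 / dot w w) *: (w *m w^T).
exists H; last first.
  exists k; rewrite /H mulmxBl mul1mx -scalemxAl mul_outer scalerA.
  suff -> : 2 / dot w w * dot w v = 1 by rewrite scale1r /w subKr.
  have wwE : dot w w = 2 * dot w v.
    rewrite /w !(dotDl, dotDr) -!scaleNr !(dotZl, dotZr) (dotC e v) ee -kk.
    by ring.
  by rewrite mulrAC -wwE divff.
split.
  by rewrite /H linearB /= trmx1 linearZ /= trmx_mul trmxK.
rewrite /H mulmxBl mul1mx mulmxBr mulmx1 -scalemxAl -scalemxAr mulmxA mul_outer.
rewrite -scalemxAl !scalerA divfK // -scalerBl.
have -> : 2 / dot w w - 2 / dot w w * 2 = - (2 / dot w w) by ring.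
by rewrite scaleNr opprK subrK.
Qed.

Lemma sym_block n (B : 'M[R]_(1 + n)) a : B^T = B ->
  B *m delta_mx (0 : 'I_n.+1) (0 : 'I_1) = a *: delta_mx 0 0 ->
  B = block_mx a%:M 0 0 (drsubmx B).
Proof.
move=> symB Be.
have B0 (i j : 'I_n.+1) : j = 0 :> nat -> B i j = a *+ (i == 0 :> nat).
  move=> j0; have -> : j = 0 by apply: val_inj.
  have := congr1 (fun u : 'cV[R]_n.+1 => u i 0) Be.
  by rewrite -colE !mxE eqxx andbT mulr_natr.
rewrite -[LHS]submxK; congr block_mx; apply/matrixP => i j; rewrite !mxE.
- by rewrite B0 //= !ord1.
- by rewrite -symB mxE B0 //= ord1.
- by rewrite B0 //= ord1.
Qed.

(** Induction on the size: conjugation by a Householder reflection isolates one eigenvalue [a] in a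
    1 by 1 block, and the remaining block is symmetric, hence diagonalized by induction. *)
Lemma spectral n (M : 'M[R]_n) : M^T = M ->
  exists P, exists2 d : 'rV[R]_n, P^T *m P = 1%:M & M = P^T *m diag_mx d *m P.
Proof.
elim: n M => [|n IHn] M symM.
  by exists 0, 0; apply/matrixP => - [].
have [a [v v_neq0 Mv]] := sym_eigenvector symM.
have [H [symH HH] [k Hv]] := householder v_neq0.
have k_neq0 : k != 0.
  apply: contra v_neq0 => /eqP k0; apply/eqP.
  by rewrite -[v]mul1mx -HH -mulmxA Hv k0 scale0r mulmx0.
pose B : 'M_(1 + n) := H *m M *m H.
have symB : B^T = B by rewrite /B !trmx_mul symH symM !mulmxA.
have Be : B *m delta_mx 0 (0 : 'I_1) = a *: delta_mx 0 0.
  apply: (scalerI k_neq0); rewrite scalemxAr -Hv /B -[LHS]mulmxA (mulmxA H H).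
  by rewrite HH mul1mx -mulmxA Mv -scalemxAr Hv !scalerA mulrC.
have ME : M = H *m B *m H.
  by rewrite /B !mulmxA HH mul1mx -mulmxA HH mulmx1.
clearbody B; have BE := sym_block symB Be.
have [|Q [d QQ QE]] := IHn (drsubmx B).
  by rewrite trmx_drsub symB.
pose Q1 : 'M_(1 + n) := block_mx 1%:M 0 0 Q.
have Q1Q1 : Q1^T *m Q1 = 1%:M.
  rewrite tr_block_mx mulmx_block !trmx0 trmx1.
  rewrite !(mul0mx, mulmx0, mul1mx, addr0, add0r) QQ.
  by rewrite -scalar_mx_block.
have {}BE : B = Q1^T *m diag_mx (row_mx a%:M d) *m Q1.
  rewrite BE {1}QE diag_mx_row tr_block_mx !mulmx_block !trmx0 trmx1.
  rewrite !(mul0mx, mulmx0, mul1mx, mulmx1, addr0, add0r); congr block_mx.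
  by apply/matrixP => i j; rewrite !ord1 !mxE eqxx.
exists (Q1 *m H), (row_mx a%:M d).
  by rewrite trmx_mul symH mulmxA -(mulmxA H) Q1Q1 mulmx1.
by rewrite ME BE trmx_mul symH !mulmxA.
Qed.

Definition psd n (M : 'M[R]_n) := forall x : 'cV_n, 0 <= dot x (M *m x).

Definition posdef n (M : 'M[R]_n) :=
  forall x : 'cV_n, x != 0 -> 0 < dot x (M *m x).

Lemma psd_gram n (N : 'M[R]_n) : N^T = N -> psd N ->
  exists U : 'M[R]_n, N = U *m U^T.
Proof.
move=> symN psdN; have [P [d PP NE]] := spectral symN.
have PP' := mulmx1C PP.
have d_ge0 i : 0 <= d 0 i.
  (* The columns of [P^T] are eigenvectors, and the form at the [i]-th one is [d 0 i]. *)
  have := psdN (P^T *m delta_mx i 0).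
  rewrite NE -!mulmxA (mulmxA P) PP' mul1mx dot_mull trmxK.
  rewrite (mulmxA P) PP' mul1mx.
  rewrite mul_diag_mx dotE (bigD1 i) //= big1 => [|j /negbTE ji].
    by rewrite !mxE !eqxx mul1r mulr1 addr0.
  by rewrite !mxE ji mul0r.
exists (P^T *m diag_mx (map_mx Num.sqrt d)).
rewrite trmx_mul trmxK tr_diag_mx {1}NE !mulmxA; congr (_ *m _).
rewrite -!mulmxA; congr (_ *m _); rewrite mulmx_diag; congr diag_mx.
by apply/rowP => i; rewrite !mxE -expr2 sqr_sqrtr.
Qed.

(** Both matrices have the same left kernel: if [x *m U *m U^T = 0], then [x *m U] has squared
    length zero. *)
Lemma rank_gram n m (U : 'M[R]_(n, m)) : \rank (U *m U^T) = \rank U.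
Proof.
suff kerE : (kermx (U *m U^T) == kermx U)%MS.
  have : \rank (kermx (U *m U^T)) = \rank (kermx U) by rewrite (eqmxP kerE).
  rewrite !mxrank_ker => /(congr1 (subn n)).
  by rewrite !subKn ?rank_leq_row.
apply/andP; split; last first.
  by apply/sub_kermxP; rewrite mulmxA mulmx_ker mul0mx.
apply/row_subP => i; apply/sub_kermxP.
set x := row i _.
have xUU : x *m (U *m U^T) = 0 by rewrite -row_mul mulmx_ker row0.
apply/eqP; rewrite -trmx_eq0 -dot_eq0 /dot trmxK trmx_mul mulmxA -(mulmxA x).
by rewrite xUU mul0mx mxE.
Qed.

Lemma rank_diag_mx n (d : 'rV[R]_n) :
  \rank (diag_mx d) = (\sum_i (d 0%R i != 0%R))%N.
Proof.
elim: n d => [|n IHn] d; first by rewrite big_ord0 [diag_mx d]thinmx0 mxrank0.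
pose d' : 'rV_(1 + n) := d.
transitivity (\rank (diag_mx (row_mx (lsubmx d') (rsubmx d')))).
  by rewrite hsubmxK.
rewrite big_ord_recl diag_mx_row rank_diag_block_mx IHn.
congr (_ + _)%N.
  rewrite rank_rV; congr (nat_of_bool (~~ _)); apply/eqP/eqP => [|d0].
    by move/rowP/(_ 0); rewrite !mxE lshift0 eqxx mulr1n.
  by apply/rowP => i; rewrite !mxE !ord1 lshift0 d0 mul0rn.
apply: eq_bigr => i _; rewrite mxE; congr (nat_of_bool (d _ _ != _)).
exact: val_inj.
Qed.

Lemma multiplicity_diag n (P : 'M[R]_n) d x : P^T *m P = 1%:M ->
  multiplicity (P^T *m diag_mx d *m P) x = (\sum_i (d 0%R i == x))%N.
Proof.
move=> PP; have [_ uP] := mulmx1_unit PP.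
rewrite /multiplicity /eigenspace mxrank_ker.
have -> : P^T *m diag_mx d *m P - x%:M
    = P^T *m diag_mx (d - const_mx x) *m P.
  rewrite linearB /= diag_const_mx mulmxBr mulmxBl; congr (_ - _).
  by rewrite mul_mx_scalar -scalemxAl PP scalemx1.
rewrite mxrankMfree ?row_free_unit // -mxrank_tr trmx_mul trmxK.
rewrite mxrankMfree ?row_free_unit // tr_diag_mx rank_diag_mx.
set k := (\sum_i ((d - const_mx x)%R 0%R i != 0%R))%N.
have kE : (\sum_i (d 0%R i == x) + k)%N = n.
  rewrite -big_split /= -[RHS]card_ord -sum1_card.
  by apply: eq_bigr => i _; rewrite !mxE subr_eq0; case: (_ == _).
by rewrite -[in LHS]kE addnK.
Qed.

Lemma mem_eigenvalues n (P : 'M[R]_n) d x : P^T *m P = 1%:M ->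
  x \in eigenvalues (P^T *m diag_mx d *m P) = [exists i, d 0 i == x].
Proof.
move=> PP; rewrite /eigenvalues.
have := roots_on_rootsR (monic_neq0 (char_poly_monic (P^T *m diag_mx d *m P))).
move/(_ x); rewrite in_itv /= => <-; rewrite -eigenvalue_root_char /eigenvalue.
rewrite -mxrank_eq0 -/(multiplicity _ _) multiplicity_diag // sum_nat_eq0.
rewrite negb_forall; apply: eq_existsb => i.
by case: (d 0 i == x).
Qed.

Lemma neg_inertia_diag n (P : 'M[R]_n) d : P^T *m P = 1%:M ->
  neg_inertia (P^T *m diag_mx d *m P) = #|[set i | d 0 i < 0]|.
Proof.
move=> PP; rewrite /neg_inertia.
under eq_bigr do rewrite multiplicity_diag //.
(* After the exchange, an index [i] contributes only at the eigenvalue [d 0 i], which the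
   duplicate-free list contains exactly once. *)
rewrite exchange_big /= -sum1_card [RHS]big_mkcond; apply: eq_bigr => i _.
have ev : d 0 i \in eigenvalues (P^T *m diag_mx d *m P).
  by rewrite mem_eigenvalues //; apply/existsP; exists i.
have uniq_ev : uniq (eigenvalues (P^T *m diag_mx d *m P)).
  apply: (@sorted_uniq _ <%R); [exact: lt_trans|exact: ltxx|].
  exact: sorted_roots.
rewrite big_mkcond (bigD1_seq (d 0 i)) //= big1 => [|x /negbTE xd].
  by rewrite inE eqxx addn0; case: ifP.
by rewrite eq_sym xd if_same.
Qed.

End Spectral.

(** * Quadratic forms: descriptions of [lambda1] and of the inertia, kernels, and the group
    inverse *)

Section Forms.
Variable R : realType.

Lemma form_diag n (P : 'M[R]_n) d x :
  dot x (P^T *m diag_mx d *m P *m x) = \sum_i d 0 i * (P *m x) i 0 ^+ 2.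
Proof.
rewrite -!mulmxA -dot_mull mul_diag_mx dotE; move: (P *m x) => y.
by apply: eq_bigr => i _; rewrite mxE mulrCA expr2.
Qed.

Lemma form_basis n (P : 'M[R]_n) d x : P *m P^T = 1%:M ->
  dot (P^T *m x) (P^T *m diag_mx d *m P *m (P^T *m x))
    = \sum_i d 0 i * x i 0 ^+ 2.
Proof. by move=> PP; rewrite form_diag mulmxA PP mul1mx. Qed.

Lemma dot_delta n (x : 'cV[R]_n) i : dot x (delta_mx i 0) = x i 0.
Proof. by rewrite /dot -colE !mxE. Qed.

Lemma psd_or_neg n (M : 'M[R]_n) : psd M \/ exists u, dot u (M *m u) < 0.
Proof.
have [|h] := pselect (psd M); first by left.
by right; have /existsNP[u /negP] := h; rewrite -ltNge => ?; exists u.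
Qed.

(** With [M = U *m U^T], the form at [x] is the squared length of [U^T *m x]. *)
Lemma psd_kernel n (M : 'M[R]_n) x : M^T = M -> psd M ->
  dot x (M *m x) = 0 -> M *m x = 0.
Proof.
move=> symM /(psd_gram symM)[U ->]; rewrite -mulmxA -[U in dot _ (U *m _)]trmxK.
by rewrite -dot_mull => /eqP; rewrite dot_eq0 => /eqP ->; rewrite mulmx0.
Qed.

Lemma lambda1P n (A : 'M[R]_n) : A^T = A -> (0 < n)%N ->
  (exists2 v : 'cV_n, v != 0 & A *m v = lambda1 A *: v) /\
  psd ((lambda1 A)%:M - A).
Proof.
move=> symA n_gt0; have [P [d PP AE]] := spectral symA.
have PP' := mulmx1C PP.
have ev i : d 0 i \in eigenvalues A.
  by rewrite AE mem_eigenvalues //; apply/existsP; exists i.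
have le_l i : d 0 i <= lambda1 A.
  exact: (@le_bigmax_seq _ _ _ _ _ (d 0 i) xpredT id).
(* By [ev] the list is nonempty, so its head is a genuine eigenvalue and not the default 0; each
   maximum then stays in the list. *)
have : lambda1 A \in eigenvalues A.
  rewrite /lambda1; have := ev (Ordinal n_gt0).
  case: (eigenvalues A) => //= x s _; rewrite big_cons.
  rewrite maxEle; case: ifP => // _; last exact: mem_head.
  elim: s => [|y s IHs] /=; first by rewrite big_nil mem_head.
  rewrite big_cons maxEle; case: ifP => // _; last by rewrite !inE eqxx orbT.
  by move: IHs; rewrite !inE => /orP[->|->] //; rewrite !orbT.
rewrite {2}AE mem_eigenvalues // => /existsP[i /eqP li]; split.
  exists (P^T *m delta_mx i 0).
    rewrite -dot_eq0 dot_mull trmxK mulmxA PP' mul1mx dot_delta mxE !eqxx.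
    exact: oner_neq0.
  rewrite -li {1}AE -!mulmxA (mulmxA P) PP' mul1mx scalemxAr; congr (_ *m _).
  apply/colP => k; rewrite mul_diag_mx !mxE; case: eqP => [->//|_].
  by rewrite /= !mulr0.
move=> x; have -> : (lambda1 A)%:M - A
    = P^T *m diag_mx (const_mx (lambda1 A) - d) *m P.
  rewrite linearB /= diag_const_mx mulmxBr mulmxBl -AE; congr (_ - _).
  by rewrite mul_mx_scalar -scalemxAl PP scalemx1.
rewrite form_diag sumr_ge0 // => k _.
by rewrite !mxE mulr_ge0 ?sqr_ge0 // subr_ge0.
Qed.

Lemma form_shift n (A : 'M[R]_n) a b x :
  dot x ((a%:M - A) *m x) = (a - b) * dot x x + dot x ((b%:M - A) *m x).
Proof.
by rewrite !mulmxBl !mul_scalar_mx !dotDr !dotNr !dotZr; ring.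
Qed.

Lemma lambda1_lt n (A : 'M[R]_n) l : A^T = A -> (0 < n)%N ->
  lambda1 A < l <-> posdef (l%:M - A).
Proof.
move=> symA n_gt0; have [[v v_neq0 Av] psdl] := lambda1P symA n_gt0.
split=> [lt_l x x0|/(_ v v_neq0)].
  rewrite (form_shift _ _ (lambda1 A)) ltr_pwDl // mulr_gt0 ?dot_gt0 //.
  by rewrite subr_gt0.
rewrite mulmxBl mul_scalar_mx Av -scalerBl dotZr pmulr_lgt0 ?dot_gt0 //.
by rewrite subr_gt0.
Qed.

Lemma lambda1_eq n (A : 'M[R]_n) l : A^T = A -> (0 < n)%N ->
  lambda1 A = l <->
    psd (l%:M - A) /\ exists2 v : 'cV_n, v != 0 & (l%:M - A) *m v = 0.
Proof.
move=> symA n_gt0; have [[v v_neq0 Av] psdl] := lambda1P symA n_gt0.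
split=> [<-|[/(_ v) + [u u_neq0 lu]]].
  by split=> //; exists v; rewrite // mulmxBl mul_scalar_mx Av subrr.
rewrite mulmxBl mul_scalar_mx Av -scalerBl dotZr pmulr_lge0 ?dot_gt0 //.
rewrite subr_ge0 => le_l; apply: le_anti; rewrite le_l /=.
(* At the kernel vector [u], the product of [l - lambda1 A] with a positive number is minus a
   nonnegative form, which gives the reverse inequality. *)
have := form_shift A l (lambda1 A) u; rewrite lu dot0r => /esym/eqP.
rewrite addr_eq0 => /eqP h; rewrite -subr_le0.
by rewrite -(pmulr_lle0 _ (dot_gt0 u_neq0)) h oppr_le0 psdl.
Qed.

(** A variational form of the inertia condition. Two independent eigenvectors with negative
    eigenvalues would span a plane containing a nonzero vector orthogonal to [v], where the form is
    negative; conversely the negative eigenvector serves as both [u] and [v]. *)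
Lemma neg_inertia1P n (M : 'M[R]_n) : M^T = M ->
  neg_inertia M = 1%N <->
    (exists u, dot u (M *m u) < 0) /\
    (exists v, forall x, dot v x = 0 -> 0 <= dot x (M *m x)).
Proof.
move=> symM; have [P [d PP ME]] := spectral symM.
have PP' := mulmx1C PP.
rewrite [in neg_inertia _]ME neg_inertia_diag //; split.
  move/eqP/cards1P => [i0 dE].
  have d_lt0 i : (d 0 i < 0) = (i == i0).
    by have := in_set1 i i0; rewrite -dE inE.
  split.
    exists (P^T *m delta_mx i0 0); rewrite ME form_basis // (bigD1 i0) //= big1.
      by rewrite mxE !eqxx expr1n mulr1 addr0 d_lt0.
    by move=> i /negbTE ii0; rewrite mxE ii0 expr0n mulr0.
  exists (P^T *m delta_mx i0 0) => x.
  rewrite dotC -dot_mull dot_delta => x0.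
  rewrite ME form_diag sumr_ge0 // => i _.
  have [->|ii0] := eqVneq i i0; first by rewrite x0 expr0n mulr0.
  by rewrite mulr_ge0 ?sqr_ge0 // leNgt d_lt0.
move=> [[u u_lt0] [v vP]]; apply/eqP; rewrite eqn_leq; apply/andP; split.
  apply/card_le1_eqP => i k; rewrite !inE => di dk; apply/eqP/negPn/negP => ki.
  have ik : i != k by rewrite eq_sym.
  pose s := (P *m v) i 0; pose t := (P *m v) k 0.
  (* Coefficients of a nontrivial combination of the two eigenvectors that is orthogonal to [v]. *)
  have [a [b [ab0 abst]]] : exists a b,
      (a != 0) || (b != 0) /\ a * s + b * t = 0.
    have [s0|s0] := eqVneq s 0.
      by exists 1, 0; rewrite oner_neq0 s0; split=> //; ring.
    by exists t, (- s); rewrite oppr_eq0 s0 orbT; split=> //; ring.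
  have := vP (P^T *m (a *: delta_mx i 0 + b *: delta_mx k 0)).
  rewrite -dot_mull dotDr !dotZr !dot_delta => /(_ abst).
  rewrite ME form_basis // (bigD1 i) //= (bigD1 k) //= big1; last first.
    move=> l /andP[/negbTE li /negbTE lk].
    by rewrite !mxE li lk !mulr0 addr0 expr0n mulr0.
  rewrite !mxE !eqxx (negbTE ik) eq_sym (negbTE ik) !mulr1 !mulr0 !addr0 add0r.
  apply/negP; rewrite -ltNge; case/orP: ab0 => [a0|b0].
    rewrite ltr_wnDr ?nmulr_rlt0 ?exprn_even_gt0 ?a0 ?orbT //.
    by rewrite nmulr_rle0 // sqr_ge0.
  rewrite ltr_wnDl ?nmulr_rlt0 ?exprn_even_gt0 ?b0 ?orbT //.
  by rewrite nmulr_rle0 // sqr_ge0.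
rewrite card_gt0; apply: contraTneq u_lt0 => d0; rewrite -leNgt ME form_diag.
rewrite sumr_ge0 // => i _; rewrite mulr_ge0 ?sqr_ge0 // leNgt.
by apply/negP => di; have := in_set0 i; rewrite -d0 inE di.
Qed.

(* Replacing a kernel vector by its entrywise absolute value does not increase
   the form, which therefore still vanishes. *)
Lemma nonneg_kernel n (A : 'M[R]_n) l (v : 'cV_n) : A^T = A ->
  (forall i j, 0 <= A i j) -> psd (l%:M - A) -> v != 0 -> (l%:M - A) *m v = 0 ->
  exists2 x, (l%:M - A) *m x = 0 & dot (allones R n) x != 0.
Proof.
move=> symA A_ge0 psdM v_neq0 Mv; pose x : 'cV[R]_n := map_mx Num.norm v.
exists x; last first.
  apply: contra v_neq0; rewrite dotE psumr_eq0 => [/allP x0|i _].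
    apply/eqP/colP => i; rewrite mxE; apply/eqP.
    by have := x0 i (mem_index_enum _); rewrite /= !mxE mul1r normr_eq0.
  by rewrite !mxE mul1r.
apply: psd_kernel => //; first by rewrite linearB /= tr_scalar_mx symA.
apply: le_anti; rewrite psdM andbT -(dot0r v) -Mv !mulmxBl !mul_scalar_mx.
rewrite !dotDr !dotNr !dotZr; apply: lerB.
  rewrite le_eqVlt; apply/orP; left; apply/eqP; congr (_ * _); rewrite !dotE.
  by apply: eq_bigr => i _; rewrite mxE -normrM ger0_norm // -expr2 sqr_ge0.
rewrite !dotE ler_sum // => i _; rewrite !mxE !mulr_sumr ler_sum // => j _.
rewrite mxE (le_trans (ler_norm _)) // !normrM (ger0_norm (A_ge0 _ _)) //.
Qed.

Lemma group_inverse_sym n (M : 'M[R]_n) : M^T = M ->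
  is_group_inverse M (group_inverse M).
Proof.
move=> symM; apply: classical_sets.xgetPex; have [P [d PP ME]] := spectral symM.
have PP' := mulmx1C PP.
have mulP a b : P^T *m diag_mx a *m P *m (P^T *m diag_mx b *m P)
    = P^T *m diag_mx (\row_i (a 0 i * b 0 i)) *m P.
  by rewrite -!mulmxA (mulmxA P) PP' mul1mx (mulmxA (diag_mx a)) mulmx_diag.
(* [0^-1 = 0], so this inverts only the nonzero eigenvalues. *)
exists (P^T *m diag_mx (map_mx GRing.inv d) *m P).
rewrite /= /is_group_inverse ME !mulP.
split; congr (_ *m diag_mx _ *m _); apply/rowP => i; rewrite !mxE.
- by have [->|d0] := eqVneq (d 0 i) 0; rewrite ?mulr0 // divff ?mul1r.
- by have [->|d0] := eqVneq (d 0 i) 0; rewrite ?invr0 ?mulr0 // mulVf ?mul1r.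
- by rewrite mulrC.
Qed.

(** Only [M *m X *m M = M] matters: when [j = M *m w], the group inverse disappears from the
    quantity in the third alternative, leaving [dot j w]. *)
Lemma group_inverse_form n (M : 'M[R]_n) w : M^T = M ->
  ((M *m w)^T *m group_inverse M *m (M *m w)) 0 0 = dot (M *m w) w.
Proof.
move=> symM; have [MXM _ _] := group_inverse_sym symM.
by rewrite /dot trmx_mul symM -[in RHS]MXM !mulmxA.
Qed.

Lemma in_colspaceP n (M : 'M[R]_n) j :
  reflect (exists w, M *m w = j) (in_colspace j M).
Proof.
apply: (iffP submxP) => [[D jD]|[w <-]]; last by exists w^T; rewrite trmx_mul.
by exists D^T; rewrite -[j]trmxK jD trmx_mul trmxK.
Qed.

End Forms.

(** * Rank and semidefiniteness under a symmetric rank-one update *)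

Section RankOneUpdate.
Variable R : realType.

Lemma update_mul n (M : 'M[R]_n) (j : 'cV_n) c x :
  (M + c *: (j *m j^T)) *m x = M *m x + (c * dot j x) *: j.
Proof. by rewrite mulmxDl -scalemxAl mul_outer scalerA. Qed.

Lemma update_form n (M : 'M[R]_n) (j : 'cV_n) c x :
  dot x ((M + c *: (j *m j^T)) *m x) = dot x (M *m x) + c * dot j x ^+ 2.
Proof. by rewrite update_mul dotDr dotZr (dotC x j); ring. Qed.

Lemma update_sym n (M : 'M[R]_n) (j : 'cV_n) c :
  M^T = M -> (M + c *: (j *m j^T))^T = M + c *: (j *m j^T).
Proof. by move=> symM; rewrite linearD linearZ /= trmx_mul trmxK symM. Qed.

Lemma sym_rowspace n (M : 'M[R]_n) v (j : 'cV_n) a :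
  M^T = M -> M *m v = a *: j -> a != 0 -> (j^T <= M)%MS.
Proof.
move=> symM Mv a_neq0; rewrite -(eqmx_scale _ a_neq0) -linearZ /= -Mv.
rewrite trmx_mul symM; exact: submxMl.
Qed.

Lemma rank_one_sub n (j : 'cV[R]_n) p (M : 'M[R]_(p, n)) c :
  (j^T <= M)%MS -> (c *: (j *m j^T) <= M)%MS.
Proof. by move=> jM; rewrite scalemx_sub // (submx_trans (submxMl _ _)). Qed.

(** The updated matrix sends [v] to a nonzero multiple of [j], so [j^T] lies in both row spaces;
    adding or removing the rank-one term thus keeps each row space inside the other. *)
Lemma rank_update n (M : 'M[R]_n) (j v : 'cV_n) c :
  M^T = M -> M *m v = j -> 1 + c * dot j v != 0 ->
  \rank (M + c *: (j *m j^T))%R = \rank M.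
Proof.
move=> symM Mv q_neq0.
have Nv : (M + c *: (j *m j^T)) *m v = (1 + c * dot j v) *: j.
  by rewrite update_mul Mv scalerDl scale1r.
apply/eqP; rewrite eqn_leq !mxrankS //.
  have {1}-> : M = M + c *: (j *m j^T) + (- c) *: (j *m j^T).
    by rewrite scaleNr addrK.
  by rewrite addmx_sub // rank_one_sub // (sym_rowspace _ Nv) ?update_sym.
rewrite addmx_sub // rank_one_sub // (@sym_rowspace _ _ v _ 1) ?scale1r //.
exact: oner_neq0.
Qed.

(** Now [v] is killed by the update but not by [M], so the row space shrinks strictly; a rank-one
    term changes the rank by at most one. *)
Lemma rank_update_drop n (M : 'M[R]_n) (j v : 'cV_n) c :
  M^T = M -> j != 0 -> M *m v = j -> 1 + c * dot j v = 0 ->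
  \rank M = (\rank (M + c *: (j *m j^T))%R).+1.
Proof.
move=> symM j_neq0 Mv q0; set N := M + _.
have Nv : N *m v = 0.
  by rewrite update_mul Mv -{1}[j]scale1r -scalerDl q0 scale0r.
have NM : (N < M)%MS.
  rewrite ltmxE addmx_sub ?rank_one_sub //=; last first.
    by rewrite (@sym_rowspace _ _ v _ 1) ?scale1r ?oner_neq0.
  apply: contra j_neq0 => /submxP[D MD].
  by rewrite -Mv MD -mulmxA Nv mulmx0.
apply/eqP; rewrite eqn_leq rank_ltmx // andbT.
have {1}-> : M = N + (- c) *: (j *m j^T) by rewrite scaleNr addrK.
rewrite (leq_trans (mxrank_add _ _)) // -[X in (_ <= X)%N]addn1 leq_add2l.
rewrite (leq_trans (mxrank_scale _ _)) // (leq_trans (mxrankM_maxl _ _)) //.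
exact: rank_leq_col.
Qed.

Lemma posdef_rank n (M : 'M[R]_n) : posdef M -> \rank M = n.
Proof.
move=> pdM; apply/eqP; change (row_free M); rewrite -kermx_eq0.
apply/rowV0P => x /sub_kermxP xM.
apply/eqP; apply: contraT => x_neq0; have := pdM x^T; rewrite trmx_eq0 x_neq0.
by rewrite /dot trmxK mulmxA xM mul0mx mxE ltxx => /(_ isT).
Qed.

Lemma not_in_colspace n (M : 'M[R]_n) j : M^T = M -> ~~ in_colspace j M ->
  exists2 v, M *m v = 0 & dot j v != 0.
Proof.
rewrite /in_colspace submxE => -> /rV0Pn[k jk]; exists (col k (cokermx M)).
  by rewrite colE mulmxA mulmx_coker mul0mx.
by rewrite /dot colE mulmxA -colE mxE.
Qed.

(** Otherwise some [v] in the kernel of [M] is not orthogonal to [j]. Moving [u] along [v] until it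
    is orthogonal to [j] keeps the negative value of the form of [M], which there equals that of the
    update. *)
Lemma psd_update_colspace n (M : 'M[R]_n) (j u : 'cV_n) c : M^T = M ->
  psd (M + c *: (j *m j^T)) -> dot u (M *m u) < 0 -> exists w, M *m w = j.
Proof.
move=> symM pN u0; apply/in_colspaceP; apply: contraTT u0 => jM; rewrite -leNgt.
have [v Mv jv] := not_in_colspace symM jM.
have vMu : dot v (M *m u) = 0 by rewrite dotC dot_mull symM Mv dot0r.
have := pN (u + (- (dot j u / dot j v)) *: v).
rewrite update_form dotDr dotZr mulNr divfK // subrr expr0n mulr0 addr0.
by rewrite mulmxDr -scalemxAr Mv scaler0 addr0 dotDl dotZl vMu mulr0 addr0.
Qed.

Lemma form_line n (M : 'M[R]_n) (w y : 'cV_n) s : M^T = M ->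
  dot (y + s *: w) (M *m (y + s *: w))
    = dot y (M *m y) + 2 * s * dot (M *m w) y + s ^+ 2 * dot (M *m w) w.
Proof.
move=> symM; rewrite mulmxDr -scalemxAr !dotDr !dotDl !dotZr !dotZl.
have -> : dot w (M *m y) = dot (M *m w) y by rewrite dot_mull symM.
by rewrite (dotC y (M *m w)) (dotC w (M *m w)); ring.
Qed.

(** Nonnegativity passes from the orthogonal of [v] to that of [M *m w]: shifting [y] along [w] into
    the former adds only a nonpositive multiple of [dot (M *m w) w]. *)
Lemma form_orthogonal n (M : 'M[R]_n) (v w y : 'cV_n) : M^T = M ->
  (forall x, dot v x = 0 -> 0 <= dot x (M *m x)) ->
  dot (M *m w) w < 0 -> dot (M *m w) y = 0 -> 0 <= dot y (M *m y).
Proof.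
move=> symM vP w_lt0 wy.
have vw : dot v w != 0.
  by apply: contraTneq w_lt0 => /vP; rewrite dotC leNgt.
have := vP (y + (- (dot v y / dot v w)) *: w).
rewrite form_line // wy mulr0 addr0 dotDr dotZr mulNr divfK // subrr.
move=> /(_ erefl).
set s := _ ^+ 2 => h; have : s * dot (M *m w) w <= 0.
  by rewrite mulr_ge0_le0 ?sqr_ge0 // ltW.
by move: h; lra.
Qed.

Lemma psd_updateP n (M : 'M[R]_n) (j w : 'cV_n) c :
  M^T = M -> j != 0 -> 0 < c -> M *m w = j -> neg_inertia M = 1%N ->
  psd (M + c *: (j *m j^T)) <-> 1 + c * dot j w <= 0.
Proof.
move=> symM j_neq0 c_gt0 Mw /(neg_inertia1P symM)[[u u_lt0] [v vP]].
set N := M + _; set q := dot j w.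
have formw y s : dot (y + s *: w) (N *m (y + s *: w))
    = dot y (M *m y) + 2 * s * dot j y + s ^+ 2 * q
      + c * (dot j y + s * q) ^+ 2.
  by rewrite update_form form_line // Mw dotDr dotZr.
split=> [pN|q_le x].
  rewrite leNgt; apply/negP => q_gt.
  (* Each sign of [q] contradicts [psd N]: for [q < 0] the form at [w] is [q * (1 + c * q) < 0]; for
     [q > 0] it is negative at the translate of [u] along [w] orthogonal to [j]; for [q = 0] it
     vanishes at [w] although [N *m w = j]. *)
  have [q0|q0|q0] := ltgtP q 0.
  - have := pN w; rewrite update_form Mw dotC -/q leNgt => /negP; apply.
    by have : q * (1 + c * q) < 0; [rewrite nmulr_rlt0 | lra].
  - pose s := dot j u / q; have ju : dot j u = s * q by rewrite divfK ?gt_eqF.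
    have := pN (u + (- s) *: w); rewrite formw ju.
    have : 0 <= s ^+ 2 * q by rewrite mulr_ge0 ?sqr_ge0 // ltW.
    by move: u_lt0; lra.
  - have /eqP : N *m w = 0.
      apply: psd_kernel (update_sym _ _ symM) pN _.
      by rewrite update_form Mw dotC -/q q0 expr0n mulr0 addr0.
    by rewrite update_mul Mw -/q q0 mulr0 scale0r addr0; apply/negP.
have q_lt0 : q < 0 by rewrite -(pmulr_rlt0 _ c_gt0); lra.
(* With [y] orthogonal to [j = M *m w], the cross term vanishes and the form splits into that of [M]
   at [y] plus [s ^+ 2 * q * (1 + c * q)]. *)
have -> : x = (x - (dot j x / q) *: w) + (dot j x / q) *: w by rewrite subrK.
set y := x - _; set s := dot j x / q.
have jy : dot j y = 0 by rewrite /y dotDr dotNr dotZr divfK ?subrr ?lt_eqF.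
rewrite formw jy mulr0 addr0 add0r.
have -> : c * (s * q) ^+ 2 = s ^+ 2 * q * (c * q) by ring.
rewrite -addrA -[X in X + _ * _]mulr1 -mulrDr addr_ge0 //.
  by apply: (form_orthogonal symM vP (w := w)); rewrite Mw.
by rewrite mulr_le0 // mulr_ge0_le0 ?sqr_ge0 // ltW.
Qed.

End RankOneUpdate.

(** * The three alternatives as semidefiniteness and rank of the rescaled Gram matrix *)

Definition code_form (R : realType) (alpha beta : R) (G : sgraph) :
    'M[R]_#|G| :=
  ((1 - alpha) / (alpha - beta))%:M - adjacency R G
    + (alpha / (alpha - beta)) *: (allones R #|G| *m (allones R #|G|)^T).

Section Alternative.
Variables (R : realType) (alpha beta : R) (G : sgraph).
Hypotheses (beta_lt : beta < alpha) (alpha_gt0 : 0 < alpha).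
Hypothesis (G_gt0 : (0 < #|G|)%N).

Let A := adjacency R G.
Let j := allones R #|G|.
Let lambda := (1 - alpha) / (alpha - beta).
Let c := alpha / (alpha - beta).
Let M := lambda%:M - A.

Lemma adjacency_sym : A^T = A.
Proof. by apply/matrixP => x y; rewrite !mxE edge_sym. Qed.

Let symM : M^T = M.
Proof. by rewrite linearB /= tr_scalar_mx adjacency_sym. Qed.

Let c_gt0 : 0 < c. Proof. by rewrite divr_gt0 ?subr_gt0. Qed.

Let boundE : (alpha - beta) / - alpha = - c^-1.
Proof. by rewrite invrN mulrN invf_div. Qed.

Let j_neq0 : j != 0.
Proof.
apply/eqP => /colP /(_ (Ordinal G_gt0)) /eqP.
by rewrite !mxE oner_eq0.
Qed.

Let N := code_form alpha beta G.

Let symN : N^T = N. Proof. exact: update_sym. Qed.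

(** With the next one, this translates the bound of the third alternative into the sign condition on
    the rank-one update. *)
Let le_bound q : (q <= - c^-1) = (1 + c * q <= 0).
Proof.
by rewrite -(ler_pM2l c_gt0) mulrN divff ?lt0r_neq0 // -subr_le0 opprK addrC.
Qed.

Let eq_bound q : (q == - c^-1) = (1 + c * q == 0).
Proof.
rewrite -(inj_eq (mulfI (lt0r_neq0 c_gt0))) mulrN divff ?lt0r_neq0 //.
by rewrite -addr_eq0 addrC.
Qed.

Let posdefN : posdef M -> posdef N.
Proof.
move=> pdM x x0; rewrite update_form ltr_pwDl ?pdM //.
by rewrite mulr_ge0 ?sqr_ge0 // ltW.
Qed.

Let psdN : psd M -> psd N.
Proof.
move=> pM x; rewrite update_form addr_ge0 ?pM //.
by rewrite mulr_ge0 ?sqr_ge0 // ltW.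
Qed.

Let posdef_psd n (B : 'M[R]_n) : posdef B -> psd B.
Proof.
move=> pB x; have [->|x0] := eqVneq x 0; first by rewrite mulmx0 dot0r.
exact/ltW/pB.
Qed.

Let rank_singular : psd M -> (exists2 v : 'cV_#|G|, v != 0 & M *m v = 0) ->
  \rank N = (\rank M).+1.
Proof.
move=> pM [v v0 Mv].
have [|x Mx jx] := nonneg_kernel adjacency_sym _ pM v0 Mv.
  by move=> x y; rewrite mxE ler0n.
(* [M] is itself a rank-one update of [N], with [N x] proportional to [j]. *)
have -> : M = N + (- c) *: (j *m j^T) by rewrite /N scaleNr addrK.
(* This scaling makes [N] send the vector to [j]; its dot product with [j] is then [c^-1], exactly
   the degenerate case for the coefficient [- c]. *)
apply: (@rank_update_drop _ _ _ _ ((c * dot j x)^-1 *: x)) => //.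
  rewrite -scalemxAr update_mul Mx add0r scalerA mulVf ?scale1r //.
  by rewrite mulf_neq0 // gt_eqF.
rewrite dotZr invfM -mulrA mulVf // mulr1 mulNr divff ?subrr // gt_eqF //.
Qed.

Let codimE : codimension A lambda = \rank M.
Proof.
rewrite /codimension /multiplicity /eigenspace mxrank_ker.
rewrite subKn ?rank_leq_row //.
by rewrite -mxrank_opp opprB.
Qed.

Lemma code_alternativeP r :
  code_alternative alpha beta G #|G| r <-> psd N /\ (\rank N)%:Z = r.
Proof.
rewrite /code_alternative -/lambda -/A -/M -/j boundE codimE.
have ltlP := lambda1_lt lambda adjacency_sym G_gt0.
have eqlP := lambda1_eq lambda adjacency_sym G_gt0.
have qE w : M *m w = j -> (j^T *m group_inverse M *m j) 0 0 = dot j w.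
  by move=> <-; apply: group_inverse_form.
split=> [|[pN rE]].
  case=> [[/ltlP pM <-]|[/eqlP[pM kM] rE]|[inertia /in_colspaceP[w Mw]]].
  - by have pN := posdefN pM; split; [exact: posdef_psd|rewrite posdef_rank].
  - by split; [exact: psdN|rewrite rank_singular // -addn1 PoszD rE subrK].
  - rewrite (qE w Mw) le_bound eq_bound => q_le rE; split.
      by apply/(psd_updateP symM j_neq0 c_gt0 Mw).
    case: eqP rE => [q0|/eqP q0]; last by rewrite /N (rank_update symM Mw).
    by rewrite (rank_update_drop symM j_neq0 Mw q0) -addn1 PoszD => /addIr.
(* A semidefinite [M] gives the second or first alternative according to whether its kernel is
   nonzero; a negative value gives the third. *)
have [pM|[u u_lt0]] := psd_or_neg M.
  have [kM|kM] := pselect (exists2 v : 'cV_#|G|, v != 0 & M *m v = 0).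
    apply: Or32; split; first exact/eqlP.
    by rewrite -rE rank_singular // -addn1 PoszD addrK.
  have pdM : posdef M.
    move=> x x0; rewrite lt0r pM andbT; apply/negP => /eqP xMx; apply: kM.
    by exists x => //; apply: psd_kernel.
  apply: Or31; split; first exact/ltlP.
  by rewrite -rE posdef_rank //; apply: posdefN.
apply: Or33; have [w Mw] := psd_update_colspace symM pN u_lt0.
have inertia : neg_inertia M = 1%N.
  apply/(neg_inertia1P symM); split; first by exists u.
  (* On the orthogonal of [j] the forms of [M] and [N] agree. *)
  exists j => x jx; have := pN x.
  by rewrite update_form jx expr0n mulr0 addr0.
rewrite (qE w Mw) le_bound eq_bound; split=> //.
- by apply/in_colspaceP; exists w.
- by apply/(psd_updateP symM j_neq0 c_gt0 Mw).
- case: eqP => [q0|/eqP q0]; last by rewrite -rE /N (rank_update symM Mw).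
  by rewrite (rank_update_drop symM j_neq0 Mw q0) -addn1 PoszD rE.
Qed.

End Alternative.

(** * Passage between spherical codes and Gram matrices *)

Section Codes.
Variable R : realType.

(** The maximal free family of rows selected by [maxrankfun] is a basis of the span; this links the
    rank of a code to a matrix rank. *)
Lemma dim_span_rows n m (U : 'M[R]_(n, m)) :
  \dim <<[seq (row i U)^T | i <- enum 'I_n]>>%VS = \rank U.
Proof.
pose f := maxrankfun U.
pose Y := [tuple (row (f i) U)^T | i < \rank U].
have YE c : \sum_(i < \rank U) c i *: Y`_i = ((\row_i c i) *m rowsub f U)^T.
  rewrite mulmx_sum_row linear_sum; apply: eq_bigr => i _.
  by rewrite -tnth_nth tnth_mktuple mxE linearZ row_rowsub.
have freeY : free Y.
  apply/freeP => c; rewrite YE => /eqP; rewrite trmx_eq0.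
  rewrite mulmx_free_eq0 ?maxrowsub_free // => /eqP/rowP c0 i.
  by have := c0 i; rewrite !mxE.
transitivity (\dim <<Y>>%VS); last by rewrite (eqP freeY) size_tuple.
congr (\dim _); apply/eqP; rewrite eqEsubv; apply/andP; split.
  apply/span_subvP => x /mapP[i _ ->].
  have /submxP[D ->] : (row i U <= rowsub f U)%MS.
    by rewrite eq_maxrowsub row_sub.
  have -> : D = \row_k D 0 k by apply/rowP => k; rewrite mxE.
  rewrite -YE memv_suml // => k _; rewrite memvZ // memv_span //.
  by rewrite -tnth_nth mem_tnth.
apply/span_subvP => x /mapP[i _ ->]; apply/memv_span/mapP.
by exists (f i); rewrite ?mem_enum.
Qed.

Lemma row_gram n m (U : 'M[R]_(n, m)) i k :
  (U *m U^T) i k = dot (row i U)^T (row k U)^T.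
Proof. by rewrite mxE dotE; apply: eq_bigr => l _; rewrite !mxE. Qed.

Variables (alpha beta : R) (G : sgraph).
Hypothesis beta_lt : beta < alpha.

Lemma code_formE i k : ((alpha - beta) *: code_form alpha beta G) i k =
  if i == k then 1
  else if edge (enum_val i) (enum_val k) then beta else alpha.
Proof.
have ab : alpha - beta != 0 by rewrite subr_eq0 gt_eqF.
rewrite !mxE big_ord1 !mxE mulr1.
have [->|ik] := eqVneq i k.
  by rewrite edge_irrefl /= mulr1n mulr0n; field.
by case: (edge (enum_val i) (enum_val k)); rewrite /= ?mulr1n ?mulr0n; field.
Qed.

Lemma code_form_gram m (U : 'M[R]_(#|G|, m)) :
  U *m U^T = (alpha - beta) *: code_form alpha beta G ->
  psd (code_form alpha beta G) /\ \rank (code_form alpha beta G) = \rank U.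
Proof.
move=> UU; have ab : 0 < alpha - beta by rewrite subr_gt0.
split=> [x|]; last by rewrite -(rank_gram U) UU mxrank_scale_nz // gt_eqF.
rewrite -(pmulr_rge0 _ ab) -dotZr scalemxAl -UU -mulmxA.
by rewrite -[U in U *m (_ *m _)]trmxK -dot_mull dot_ge0.
Qed.

(** The code vectors, listed in the order of the vertices of [G] through the inverse isomorphism,
    become the rows of a matrix with the prescribed Gram matrix. *)
Lemma code_gram m (S : {fset 'cV[R]_m}) :
  spherical_code alpha beta S -> isomorphic (beta_graph beta S) G ->
  [/\ #|` S|%fset = #|G|, psd (code_form alpha beta G)
    & \rank (code_form alpha beta G) = code_rank S].
Proof.
move=> [S_neq0 unitS dotS] [f [bij_f edge_f]]; have [g fK gK] := bij_f.
pose u (i : 'I_#|G|) : 'cV[R]_m := val (g (enum_val i)).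
pose U := \matrix_(i < #|G|) (u i)^T.
have rowU i : (row i U)^T = u i by rewrite rowK trmxK.
have uS i : u i \in S by apply: valP.
have UU : U *m U^T = (alpha - beta) *: code_form alpha beta G.
  apply/matrixP => i k; rewrite row_gram !rowU code_formE.
  have [->|ik] := eqVneq i k; first exact: unitS.
  have gik : g (enum_val i) != g (enum_val k).
    by rewrite (inj_eq (can_inj gK)) (inj_eq enum_val_inj).
  have uik : u i != u k by rewrite (inj_eq val_inj).
  have := edge_f (g (enum_val i)) (g (enum_val k)).
  rewrite !gK => ->; rewrite /= /beta_edge gik /=; case: eqP => // dot_neq.
  by have [] := dotS _ _ (uS i) (uS k) uik.
have [psdN rankN] := code_form_gram UU; split=> //.
  by rewrite cardfE; apply: bij_eq_card bij_f.
rewrite rankN -dim_span_rows /code_rank; congr (\dim _); apply: eq_span => x.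
apply/mapP/idP => [[i _ ->]|xS]; first by rewrite rowU.
exists (enum_rank (f [` xS]%fset)); first exact: mem_enum.
by rewrite rowU /u enum_rankK fK.
Qed.

Lemma isomorphic_sym (H K : sgraph) : isomorphic H K -> isomorphic K H.
Proof.
move=> [f [[g fK gK] edge_f]]; exists g; split; first by exists f.
by move=> x y; rewrite -edge_f !gK.
Qed.

Lemma gram_code : alpha < 1 -> (0 < #|G|)%N -> psd (code_form alpha beta G) ->
  exists m (S : {fset 'cV[R]_m}),
    [/\ spherical_code alpha beta S,
        code_rank S = \rank (code_form alpha beta G)
      & isomorphic (beta_graph beta S) G].
Proof.
move=> alpha_lt G_gt0 psdN.
have symN : (code_form alpha beta G)^T = code_form alpha beta G.
  by apply: update_sym; rewrite linearB /= tr_scalar_mx adjacency_sym.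
have [V NE] := psd_gram symN psdN.
(* The square root restores the factor separating [code_form] from the Gram matrix. *)
pose U := Num.sqrt (alpha - beta) *: V.
have UU : U *m U^T = (alpha - beta) *: code_form alpha beta G.
  rewrite linearZ /= -scalemxAl -scalemxAr scalerA -expr2 sqr_sqrtr -?NE //.
  by rewrite subr_ge0 ltW.
pose u i : 'cV[R]_#|G| := (row i U)^T.
have dotu i k : dot (u i) (u k) = if i == k then 1
    else if edge (enum_val i) (enum_val k) then beta else alpha.
  by rewrite -row_gram UU code_formE.
(* Distinct indices have dot product [alpha] or [beta], both below 1, so they cannot give the same
   unit vector. *)
have u_inj : injective u.
  move=> i k uik; apply/eqP; have := dotu i k; rewrite {1}uik dotu eqxx.
  case: eqP => // _ /eqP; case: (edge _ (enum_val k)) => /eqP e;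
    move: beta_lt alpha_lt; rewrite -e.
    by move=> h /(lt_trans h); rewrite ltxx.
  by rewrite ltxx.
pose S := [fset u i | i in 'I_#|G|]%fset.
have uS i : u i \in S by apply: in_imfset.
have Su x : x \in S -> exists i, x = u i by move=> /imfsetP[i _ ->]; exists i.
exists #|G|, S; split.
- split=> [|x /Su[i ->]|x y /Su[i ->] /Su[k ->] uik]; last first.
  + have /negbTE ik : i != k by apply: contraNneq uik => ->.
    by rewrite dotu ik; case: (edge _ _); [right|left].
  + by rewrite dotu eqxx.
  by apply/fset0Pn; exists (u (Ordinal G_gt0)).
- rewrite /code_rank (code_form_gram UU).2 -dim_span_rows; congr (\dim _).
  apply: eq_span => x; apply/idP/mapP => [/Su[i ->]|[i _ ->]]; last exact: uS.
  by exists i => //; apply: mem_enum.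
apply: isomorphic_sym.
pose h (x : G) : beta_graph beta S := [` uS (enum_rank x)]%fset.
exists h; have h_inj : injective h.
  by move=> x y /(congr1 val) /u_inj /enum_rank_inj.
split; last first.
  move=> x y; rewrite /= /beta_edge (inj_eq h_inj) dotu (inj_eq enum_rank_inj).
  rewrite !enum_rankK; have [->|xy] /= := eqVneq x y.
    by rewrite edge_irrefl.
  by case: (edge _ _); rewrite ?eqxx // gt_eqF.
(* As an image of the index set, [S] has at most as many elements as [G], so injectivity
   suffices. *)
apply: inj_card_bij h_inj _; rewrite -cardfE.
by rewrite (leq_trans (leq_imfset_card _ _ _)) // size_enum_ord.
Qed.

End Codes.

Theorem theorem4p2 (R : realType) (alpha beta : R)
    (beta_ge : -1 <= beta) (beta_lt : beta < alpha)
    (alpha_lt : alpha < 1) (alpha_gt0 : 0 < alpha) :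
  (forall (m : nat) (S : {fset 'cV[R]_m}) (n : nat) (r : int) (G : sgraph),
      spherical_code alpha beta S ->
      #|` S|%fset = n ->
      (code_rank S)%:Z = r ->
      isomorphic (beta_graph beta S) G ->
      code_alternative alpha beta G n r)
  /\
  (forall (n : nat) (r : int) (G : sgraph),
      (0 < n)%N ->
      #|G| = n ->
      code_alternative alpha beta G n r ->
      exists (m : nat) (S : {fset 'cV[R]_m}),
        [/\ spherical_code alpha beta S,
            (code_rank S)%:Z = r
          & isomorphic (beta_graph beta S) G]).
Proof.
split=> [m S n r G codeS <- rE isoG|n r G n_gt0 nE].
  have [cardS psdN rankN] := code_gram beta_lt codeS isoG.
  rewrite cardS; apply/code_alternativeP => //.
    by rewrite -cardS cardfs_gt0; case: codeS.
  by rewrite rankN rE.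
rewrite -nE in n_gt0 *; case/code_alternativeP => // psdN <-.
have [m [S [codeS rankS isoG]]] := gram_code beta_lt alpha_lt n_gt0 psdN.
by exists m, S; rewrite rankS.
Qed.
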